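(* Let $\mathfrak g$ be an affine Lie algebra of type $X_N^{(r)}$, $\ell$ a positive integer, and $\mathcal P_\ell$ its truncated polynomial representation, with its projective action of $\Gamma_1(r)$. Let $\mathcal P_\ell=\bigoplus_\lambda n_\lambda V_\lambda$, where $V_\lambda$ is an irreducible $\mathring W$-module corresponding to $\lambda$ and $\lambda$ ranges over the isomorphism classes of irreducible $\mathring W$-modules. Then, for each $\lambda$, $n_\lambda V_\lambda$ is invariant under the action of $\Gamma_1(r)$. In particular, $\Gamma_1(r)$ stabilizes $\mathcal A_\ell$ and $\mathcal P_\ell^{\mathring W}$.
   Context: Setting. $\mathfrak g$ is an affine Lie algebra of type $X_N^{(r)}$ (Kac's notation) with simple roots $\alpha_0,\dots,\alpha_n$, labels $a_0,\dots,a_n$ and dual Coxeter number $h^\vee$. $\mathring{\mathfrak g}$ is the finite-dimensional simple Lie algebra with simple roots $\alpha_1,\dots,\alpha_n$, with Cartan subalgebra $\mathring{\mathfrak h}$, Weyl group $\mathring W$, sign character $\varepsilon$ of $\mathring W$, and weight, root, coweight and coroot lattices $\mathring P,\mathring Q,\mathring P^\vee,\mathring Q^\vee$. $\langle\cdot,\cdot\rangle$ is the normalized invariant form, used to identify $\mathring{\mathfrak h}$ with $\mathring{\mathfrak h}^*$. Put $M=\mathring Q^\vee$ if $r\le a_0$ and $M=\mathring Q$ if $r>a_0$, and $M^\circ=\{v:\langle v,\lambda\rangle\in\mathbb Z\ \forall\lambda\in M\}$. Let $m$ be the least positive integer with $m\langle M^\circ,\mathring P\rangle\subseteq\mathbb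 Z$, let $\delta$ be the basic imaginary root of $\mathfrak g$, and let $Q^\vee=\mathring Q^\vee\oplus\mathbb Z\delta$ be the coroot lattice (the canonical central element $K$ being identified with $\delta$). The extended Heisenberg group is $\mathcal H^e=\mathring P\ltimes(M^\circ\oplus\frac1m\mathbb Z\delta)$. Its elements are written $(\alpha,\beta,u)$ with $\alpha\in\mathring P$, $\beta\in M^\circ$, $u\delta\in\frac1m\mathbb Z\delta$, where $(\alpha,0,0)=t_\alpha$ (the element $\alpha$ of $\mathring P$), $(0,\beta,0)=p_\beta$ and $(0,0,u)=p_{u\delta}=u\delta$ (elements of the second factor), with multiplication $(\alpha,\beta,u)(\alpha',\beta',u')=(\alpha+\alpha',\beta+\beta',u+u'+\frac12\langle\alpha',\beta\rangle-\frac12\langle\alpha,\beta'\rangle)$, and $(\alpha,\beta,u)=t_\alpha p_\beta p_{(u+\frac12\langle\alpha,\beta\rangle)\delta}$. The finite extended Heisenberg group is $\mathcal H^e_\ell=\mathcal H^e/\big((\ell+h^\vee)M\ltimes(\ell+h^\vee)Q^\vee\big)$. $\mathring W$ acts on $\mathcal H^e_\ell$ through its actions on the lattices, and the finite extended double affine Weyl group is $\widetilde W^e_\ell=\mathring W\ltimes\mathcal H^e_\ell$. $\Gamma_1(r)$ is the group of matrices in $SL(2,\mathbb Z)$ congruent to $\begin{pmatrix}1&*\\0&1\end{pmatrix}$ modulo $r$. It acts on $\mathcal H^e_\ell$, and on $\widetilde W^e_\ell$ (leaving $\mathring W$ invariant), by $(\alpha,\beta,u)\cdot\begin{pmatrix}a&b\\c&d\end{pmatrix}=(a\alpha+c\beta,\,b\alpha+d\beta,\,u)$.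 The truncated polynomial representation of $\widetilde W^e_\ell$ is $\mathcal P_\ell=\mathbb C[G_\ell]$, $G_\ell=\mathring P/(\ell+h^\vee)M$, with $w\cdot e^\lambda=e^{w(\lambda)}$, $t_\alpha\cdot e^\lambda=e^{\lambda+\alpha}$, $p_\beta\cdot e^\lambda=e^{\frac{2\pi i}{\ell+h^\vee}\langle\beta,\lambda\rangle}e^\lambda$, $(u\delta)\cdot e^\lambda=e^{\frac{2\pi i}{\ell+h^\vee}u}e^\lambda$ for $w\in\mathring W$, $\alpha,\lambda\in\mathring P$, $\beta\in M^\circ$, $u\in\frac1m\mathbb Z$. It is an irreducible $\widetilde W^e_\ell$-representation and is a projective representation of $\Gamma_1(r)\ltimes\widetilde W^e_\ell$; the action of $\Gamma_1(r)$ in question is the resulting homomorphism $\Gamma_1(r)\to\mathrm{PGL}(\mathcal P_\ell)$, which commutes with the action of $\mathring W$. $\mathcal A_\ell\subseteq\mathcal P_\ell$ is the subspace of alternating elements, those $f$ with $wf=\varepsilon(w)f$ for all $w\in\mathring W$, and $\mathcal P_\ell^{\mathring W}$ is the subspace of $\mathring W$-invariants. *)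

(* Defs.v *)
From HB Require Import structures.
From mathcomp Require Import all_boot all_order all_algebra.
From mathcomp Require Import generic_quotient ring_quotient.
From mathcomp Require Import boolp reals trigo.
From mathcomp Require Import complex freeg.

Set Implicit Arguments.
Unset Strict Implicit.
Unset Printing Implicit Defensive.

Import GRing.Theory Num.Theory.
Local Open Scope ring_scope.

(* The affine types X_N^(r) of Kac's tables Aff r.  The argument is the number
   n of nodes of the diagram other than the node 0, so that [Aff2_Aeven n] is
   A_{2n}^(2), [Aff2_Aodd n] is A_{2n-1}^(2) and [Aff2_D n] is D_{n+1}^(2). *)
Inductive affine_type :=
| Aff1_A of nat | Aff1_B of nat | Aff1_C of nat | Aff1_D of nat
| Aff1_E6 | Aff1_E7 | Aff1_E8 | Aff1_F4 | Aff1_G2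
| Aff2_Aeven of nat | Aff2_Aodd of nat | Aff2_D of nat | Aff2_E6
| Aff3_D4.

Definition affine_type_ok (X : affine_type) : bool :=
  match X with
  | Aff1_A n => (1 <= n)%N
  | Aff1_B n => (3 <= n)%N
  | Aff1_C n => (2 <= n)%N
  | Aff1_D n => (4 <= n)%N
  | Aff2_Aeven n => (1 <= n)%N
  | Aff2_Aodd n => (3 <= n)%N
  | Aff2_D n => (2 <= n)%N
  | _ => true
  end.

Definition rank (X : affine_type) : nat :=
  match X with
  | Aff1_A n | Aff1_B n | Aff1_C n | Aff1_D n => n
  | Aff1_E6 => 6
  | Aff1_E7 => 7
  | Aff1_E8 => 8
  | Aff1_F4 => 4
  | Aff1_G2 => 2
  | Aff2_Aeven n | Aff2_Aodd n | Aff2_D n => n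
  | Aff2_E6 => 4
  | Aff3_D4 => 2
  end%N.

(* the superscript r *)
Definition tier (X : affine_type) : nat :=
  match X with
  | Aff1_A _ | Aff1_B _ | Aff1_C _ | Aff1_D _
  | Aff1_E6 | Aff1_E7 | Aff1_E8 | Aff1_F4 | Aff1_G2 => 1
  | Aff2_Aeven _ | Aff2_Aodd _ | Aff2_D _ | Aff2_E6 => 2
  | Aff3_D4 => 3
  end%N.

(* A pair of adjacent nodes i, j of the Dynkin diagram is listed once, as
   (i, j, - a_ij, - a_ji). *)
Definition chain (p q : nat) : seq (nat * nat * nat * nat) :=
  [seq (i, i.+1, 1, 1)%N | i <- iota p (q - p)].

Definition edges (X : affine_type) : seq (nat * nat * nat * nat) :=
  match X with
  | Aff1_A 1 => [:: (0, 1, 2, 2)]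
  | Aff1_A n => (n, 0, 1, 1) :: chain 0 n
  | Aff1_B n => (0, 2, 1, 1) :: (n.-1, n, 1, 2) :: chain 1 n.-1
  | Aff1_C n => (0, 1, 1, 2) :: (n.-1, n, 2, 1) :: chain 1 n.-1
  | Aff1_D n => (0, 2, 1, 1) :: (n.-2, n, 1, 1) :: chain 1 n.-1
  | Aff1_E6 => (3, 6, 1, 1) :: (6, 0, 1, 1) :: chain 1 5
  | Aff1_E7 => (3, 7, 1, 1) :: chain 0 6
  | Aff1_E8 => (5, 8, 1, 1) :: chain 0 7
  | Aff1_F4 => (2, 3, 1, 2) :: chain 0 2 ++ chain 3 4
  | Aff1_G2 => (1, 2, 1, 3) :: chain 0 1
  | Aff2_Aeven 1 => [:: (0, 1, 4, 1)]
  | Aff2_Aeven n => (0, 1, 2, 1) :: (n.-1, n, 2, 1) :: chain 1 n.-1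
  | Aff2_Aodd n => (0, 2, 1, 1) :: (n.-1, n, 2, 1) :: chain 1 n.-1
  | Aff2_D n => (0, 1, 2, 1) :: (n.-1, n, 1, 2) :: chain 1 n.-1
  | Aff2_E6 => (2, 3, 2, 1) :: chain 0 2 ++ chain 3 4
  | Aff3_D4 => (1, 2, 3, 1) :: chain 0 1
  end%N.

Definition cartan (X : affine_type) (i j : nat) : int :=
  if i == j then 2
  else - (\sum_(e <- edges X)
            let: (p, q, x, y) := e in
            ((i, j) == (p, q)) * x + ((i, j) == (q, p)) * y)%N%:Z.

(* the labels a_i, with \sum_j a_ij a_j = 0 *)
Definition label (X : affine_type) (i : nat) : nat :=
  match X with
  | Aff1_A _ | Aff2_D _ => 1
  | Aff1_B n => if i <= 1 then 1 else 2
  | Aff1_C n => if (i == 0) || (i == n) then 1 else 2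
  | Aff1_D n => if (i <= 1) || (n.-1 <= i) then 1 else 2
  | Aff1_E6 => nth 0 [:: 1; 1; 2; 3; 2; 1; 2] i
  | Aff1_E7 => nth 0 [:: 1; 2; 3; 4; 3; 2; 1; 2] i
  | Aff1_E8 => nth 0 [:: 1; 2; 3; 4; 5; 6; 4; 2; 3] i
  | Aff1_F4 => nth 0 [:: 1; 2; 3; 4; 2] i
  | Aff1_G2 => nth 0 [:: 1; 2; 3] i
  | Aff2_Aeven n => if i == n then 1 else 2
  | Aff2_Aodd n => if (i <= 1) || (i == n) then 1 else 2
  | Aff2_E6 => nth 0 [:: 1; 2; 3; 2; 1] i
  | Aff3_D4 => nth 0 [:: 1; 2; 1] i
  end%N.

(* the dual labels a^v_i, with \sum_i a^v_i a_ij = 0 *)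
Definition colabel (X : affine_type) (i : nat) : nat :=
  match X with
  | Aff1_A _ | Aff1_C _ => 1
  | Aff1_B n => if (i <= 1) || (i == n) then 1 else 2
  | Aff1_D n => if (i <= 1) || (n.-1 <= i) then 1 else 2
  | Aff1_E6 => nth 0 [:: 1; 1; 2; 3; 2; 1; 2] i
  | Aff1_E7 => nth 0 [:: 1; 2; 3; 4; 3; 2; 1; 2] i
  | Aff1_E8 => nth 0 [:: 1; 2; 3; 4; 5; 6; 4; 2; 3] i
  | Aff1_F4 => nth 0 [:: 1; 2; 3; 2; 1] i
  | Aff1_G2 => nth 0 [:: 1; 2; 1] i
  | Aff2_Aeven n => if i == 0 then 1 else 2
  | Aff2_Aodd n => if i <= 1 then 1 else 2
  | Aff2_D n => if (i == 0) || (i == n) then 1 else 2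
  | Aff2_E6 => nth 0 [:: 1; 2; 3; 4; 2] i
  | Aff3_D4 => nth 0 [:: 1; 2; 3] i
  end%N.

Definition dual_coxeter (X : affine_type) : nat :=
  (\sum_(i < (rank X).+1) colabel X i)%N.

(* The Cartan matrix of the finite-dimensional algebra; the index i : 'I_(rank X)
   stands for the node i.+1 of the affine diagram. *)
Definition fin_cartan (X : affine_type) : 'M[int]_(rank X) :=
  \matrix_(i, j) cartan X i.+1 j.+1.

(* The rational form of h* (identified with h by the invariant form), in the
   coordinates x_i = <x, alpha_i^v>: the weight lattice is 'cV[int]_(rank X). *)
Notation hstar X := 'cV[rat]_(rank X).

Definition of_weight (X : affine_type) (x : 'cV[int]_(rank X)) : hstar X :=
  map_mx intr x.

Definition simple_root (X : affine_type) (j : 'I_(rank X)) : hstar X :=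
  of_weight (col j (fin_cartan X)).

(* The normalized form is determined by
   <alpha_i, alpha_j> = (a^v_i / a_i) a_ij. *)
Definition root_coord (X : affine_type) (x : hstar X) : hstar X :=
  invmx (map_mx intr (fin_cartan X)) *m x.

Definition form (X : affine_type) (x y : hstar X) : rat :=
  \sum_i \sum_j root_coord x i 0 * root_coord y j 0 *
    ((colabel X i.+1)%:R / (label X i.+1)%:R * (fin_cartan X i j)%:~R).

Definition simple_coroot (X : affine_type) (j : 'I_(rank X)) : hstar X :=
  (2 / form (simple_root j) (simple_root j)) *: simple_root j.

Definition zspan (X : affine_type) (b : 'I_(rank X) -> hstar X) (x : hstar X) :
    Prop :=
  exists c : 'I_(rank X) -> int, x = \sum_j b j *~ c j.

Definition weight_lattice (X : affine_type) (x : hstar X) : Prop :=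
  exists y : 'cV[int]_(rank X), x = of_weight y.

Definition latticeM (X : affine_type) : hstar X -> Prop :=
  if (tier X <= label X 0)%N then zspan (@simple_coroot X)
  else zspan (@simple_root X).

Definition latticeM_dual (X : affine_type) (x : hstar X) : Prop :=
  forall y, latticeM y -> form x y \is a Num.int.

Definition is_denominator (X : affine_type) (m : nat) : Prop :=
  forall x y, @latticeM_dual X x -> weight_lattice y ->
    m%:R * form x y \is a Num.int.

Definition least_denominator (X : affine_type) (m : nat) : Prop :=
  [/\ (0 < m)%N, is_denominator X m &
      forall k, (0 < k)%N -> is_denominator X k -> (m <= k)%N].

(* ell + h^v *)
Definition shifted_level (X : affine_type) (l : nat) : nat :=
  (l + dual_coxeter X)%N.

Definition scaledM (X : affine_type) (l : nat) : {pred 'cV[int]_(rank X)} :=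
  [pred x | `[< exists2 y, latticeM y &
                  of_weight x = (shifted_level X l)%:R *: y >]].

Arguments scaledM : clear implicits.

Lemma zspan0 (X : affine_type) (b : 'I_(rank X) -> hstar X) : zspan b 0.
Proof. by exists (fun=> 0); rewrite big1. Qed.

Lemma zspanB (X : affine_type) (b : 'I_(rank X) -> hstar X) x y :
  zspan b x -> zspan b y -> zspan b (x - y).
Proof.
move=> [c ->] [d ->]; exists (fun j => c j - d j).
by rewrite -sumrB; apply: eq_bigr => j _; rewrite mulrzBr.
Qed.

Lemma scaledM_zmod_closed (X : affine_type) (l : nat) :
  zmod_closed (scaledM X l).
Proof.
have M0 : latticeM (0 : hstar X).
  by rewrite /latticeM; case: ifP => _; apply: zspan0.
have MB (x y : hstar X) : latticeM x -> latticeM y -> latticeM (x - y).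
  by rewrite /latticeM; case: ifP => _; apply: zspanB.
split=> [|x y]; rewrite !inE.
  by apply/asboolP; exists 0 => //; rewrite scaler0 /of_weight map_mx0.
move=> /asboolP[x' Mx Ex] /asboolP[y' My Ey]; apply/asboolP.
exists (x' - y'); first exact: MB.
by rewrite /of_weight map_mxB scalerBr -Ex -Ey.
Qed.

HB.instance Definition _ (X : affine_type) (l : nat) :=
  GRing.isZmodClosed.Build 'cV[int]_(rank X) (scaledM X l)
    (scaledM_zmod_closed X l).

Notation weight_quotient X l := (Quotient.quot (scaledM X l)).

(* Only meant for points of the weight lattice, where the floor is exact. *)
Definition weight_class (X : affine_type) (l : nat) (x : hstar X) :
    weight_quotient X l :=
  \pi_(weight_quotient X l)%qT (map_mx Num.floor x).

(* Generated by the reflections x |-> x - x_i alpha_i. *)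
Inductive weyl (X : affine_type) : 'M[int]_(rank X) -> Prop :=
| weyl1 : weyl 1%:M
| weylM i w : weyl w ->
    weyl ((1%:M - col i (fin_cartan X) *m row i 1%:M) *m w).

Definition exp2pi (R : realType) (x : rat) : R[i] :=
  (cos (2 * pi * ratr x) +i* sin (2 * pi * ratr x))%C.

Notation trunc_poly R X l := {freeg (weight_quotient X l) / R[i]}.

(* The operators below are linear extensions of maps given on the basis e^x.
   Representatives are chosen by [repr]; the result does not depend on them
   for w in the Weyl group and y in [latticeM_dual]. *)
Definition weyl_op (R : realType) (X : affine_type) (l : nat)
    (w : 'M[int]_(rank X)) : trunc_poly R X l -> trunc_poly R X l :=
  fglift (fun x => << \pi_(weight_quotient X l)%qT (w *m repr x) >>).

Definition t_op (R : realType) (X : affine_type) (l : nat) (a : hstar X) :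
    trunc_poly R X l -> trunc_poly R X l :=
  fglift (fun x => << x + weight_class l a >>).

Definition p_op (R : realType) (X : affine_type) (l : nat) (b : hstar X) :
    trunc_poly R X l -> trunc_poly R X l :=
  fglift (fun x =>
    << exp2pi R (form b (of_weight (repr x)) / (shifted_level X l)%:R) *g x >>).

Definition delta_op (R : realType) (X : affine_type) (l : nat) (u : rat)
    (f : trunc_poly R X l) : trunc_poly R X l :=
  exp2pi R (u / (shifted_level X l)%:R) *: f.

(* The triple (alpha, beta, u).  Its last entry is the coordinate for which
   (alpha, beta, u) = t_alpha p_beta p_{(u + <alpha, beta> / 2) delta}, so that
   membership in P x| (M^o (+) (1/m) Z delta) bears on u + <alpha, beta> / 2. *)
Record heisenberg (X : affine_type) := Heisenberg {
  heis_t : hstar X;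
  heis_p : hstar X;
  heis_u : rat
}.

Definition in_ext_heisenberg (X : affine_type) (h : heisenberg X) : Prop :=
  [/\ weight_lattice (heis_t h), latticeM_dual (heis_p h) &
      exists2 m, least_denominator X m &
        m%:R * (heis_u h + form (heis_t h) (heis_p h) / 2) \is a Num.int].

(* The subgroup (ell + h^v) M x| (ell + h^v) Q^v acts trivially, so that this is
   also the action of the finite extended Heisenberg group. *)
Definition heis_op (R : realType) (X : affine_type) (l : nat)
    (h : heisenberg X) (f : trunc_poly R X l) : trunc_poly R X l :=
  t_op (heis_t h) (p_op (heis_p h)
    (delta_op (heis_u h + form (heis_t h) (heis_p h) / 2) f)).

(* The element w h of the extended double affine Weyl group. *)
Definition daweyl_op (R : realType) (X : affine_type) (l : nat)
    (w : 'M[int]_(rank X)) (h : heisenberg X) (f : trunc_poly R X l) :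
    trunc_poly R X l :=
  weyl_op w (heis_op h f).

Definition Gamma1 (r : nat) (g : 'M[int]_2) : Prop :=
  [/\ \det g = 1, (g 0%R 0%R = 1 %[mod r])%Z, (g 1%R 0%R = 0 %[mod r])%Z &
      (g 1%R 1%R = 1 %[mod r])%Z].

Definition sl2_act (X : affine_type) (h : heisenberg X) (g : 'M[int]_2) :
    heisenberg X :=
  Heisenberg ((g 0 0)%:~R *: heis_t h + (g 1 0)%:~R *: heis_p h)
             ((g 0 1)%:~R *: heis_t h + (g 1 1)%:~R *: heis_p h)
             (heis_u h).

(* equality of the classes in PGL *)
Definition proj_eq (R : realType) (T : Type) (V : lmodType R[i])
    (f g : T -> V) : Prop :=
  exists2 c : R[i], c != 0 & forall x, f x = c *: g x.

(* [rho g] represents in GL the image of g in PGL.  The second and third clauses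
   say that rho and the action of the extended double affine Weyl group define a
   homomorphism to PGL from its semidirect product with Gamma_1(r), in which
   g^-1 x g = x . g.  The last clause is commutation in GL, not only in PGL; it
   does not depend on the choice of the representatives. *)
Definition projective_action (R : realType) (X : affine_type) (l : nat)
    (rho : 'M[int]_2 -> {linear trunc_poly R X l -> trunc_poly R X l}) : Prop :=
  [/\ forall g, Gamma1 (tier X) g -> bijective (rho g),
      forall g g', Gamma1 (tier X) g -> Gamma1 (tier X) g' ->
        proj_eq (rho (g *m g')) (rho g \o rho g'),
      forall g w h, Gamma1 (tier X) g -> weyl w -> in_ext_heisenberg h ->
        proj_eq (daweyl_op w h \o rho g)
                (rho g \o daweyl_op w (sl2_act h g)) &
      forall g w f, Gamma1 (tier X) g -> weyl w ->
        rho g (weyl_op w f) = weyl_op w (rho g f)].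

Definition Gamma1_stable (R : realType) (X : affine_type) (l : nat)
    (rho : 'M[int]_2 -> {linear trunc_poly R X l -> trunc_poly R X l})
    (U : trunc_poly R X l -> Prop) : Prop :=
  forall g, Gamma1 (tier X) g -> forall f, U f -> U (rho g f).

Definition invariants (R : realType) (X : affine_type) (l : nat)
    (f : trunc_poly R X l) : Prop :=
  forall w, weyl w -> weyl_op w f = f.

(* The sign character is the determinant on h*. *)
Definition alternating (R : realType) (X : affine_type) (l : nat)
    (f : trunc_poly R X l) : Prop :=
  forall w, weyl w -> weyl_op w f = (\det w)%:~R *: f.

Record wmodule (R : realType) (X : affine_type) := WModule {
  wmod_sort :> lmodType R[i];
  wmod_act : 'M[int]_(rank X) -> {linear wmod_sort -> wmod_sort};
  wmod_act1 : forall v, wmod_act 1%:M v = v;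
  wmod_actM : forall w w' v, weyl w -> weyl w' ->
    wmod_act (w *m w') v = wmod_act w (wmod_act w' v)
}.

Definition irreducible_wmodule (R : realType) (X : affine_type)
    (V : wmodule R X) : Prop :=
  (exists v : V, v != 0) /\
  forall U : V -> Prop,
    U 0 -> (forall c u v, U u -> U v -> U (c *: u + v)) ->
    (forall w u, weyl w -> U u -> U (wmod_act V w u)) ->
    (forall u, U u -> u = 0) \/ (forall u, U u).

Definition iso_wmodule (R : realType) (X : affine_type)
    (V V' : wmodule R X) : Prop :=
  exists2 f : {linear V -> V'}, bijective f &
    forall w v, weyl w -> f (wmod_act V w v) = wmod_act V' w (f v).

(* Representatives of the isomorphism classes of irreducible modules. *)
Definition irreducibles (R : realType) (X : affine_type) (I : Type)
    (V : I -> wmodule R X) : Prop :=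
  [/\ forall i, irreducible_wmodule (V i),
      forall i j, iso_wmodule (V i) (V j) -> i = j &
      forall V', irreducible_wmodule V' -> exists i, iso_wmodule (V i) V'].

(* The maps phi i j assemble into an isomorphism of modules from the external
   direct sum of the (V i)^(n i) to the truncated polynomial representation. *)
Definition decomposition (R : realType) (X : affine_type) (l : nat)
    (I : finType) (V : I -> wmodule R X) (n : I -> nat)
    (phi : forall i, 'I_(n i) -> {linear V i -> trunc_poly R X l}) : Prop :=
  [/\ forall i j w v, weyl w -> phi i j (wmod_act (V i) w v) =
                                weyl_op w (phi i j v),
      forall f, exists v : forall i, 'I_(n i) -> V i,
        f = \sum_i \sum_j phi i j (v i j) &
      forall v : forall i, 'I_(n i) -> V i,
        \sum_i \sum_j phi i j (v i j) = 0 -> forall i j, v i j = 0].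

(* the summand n_i V_i *)
Definition summand (R : realType) (X : affine_type) (l : nat)
    (I : finType) (V : I -> wmodule R X) (n : I -> nat)
    (phi : forall i, 'I_(n i) -> {linear V i -> trunc_poly R X l}) (i : I)
    (f : trunc_poly R X l) : Prop :=
  exists v : 'I_(n i) -> V i, f = \sum_j phi i j (v j).

(* Main.v *)
Require Import Defs.
From mathcomp Require Import all_boot all_order all_algebra.
From mathcomp Require Import ring_quotient reals complex freeg.
From HB Require Import structures.
From mathcomp Require Import boolp.

(** The action of Gamma_1(r) on the truncated polynomial representation commutes
with the Weyl group, so each [rho g] is an endomorphism of the Weyl group module
P_l.  An endomorphism of a direct sum of irreducible modules preserves every
isotypic component: composing it with the inclusion of a copy of V_i and with
the projection onto a copy of V_k gives an intertwiner from V_i to V_k, which by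
Schur's lemma vanishes unless V_i and V_k are isomorphic, that is unless i = k
([commuting_op_summand], from [schur_zero_or_iso] and [decomposition_coord]).
The alternating elements and the invariants are the vectors on which the Weyl
group acts by the sign and by the trivial character; an operator commuting with
the group preserves any such condition. *)

Set Implicit Arguments.
Unset Strict Implicit.
Unset Printing Implicit Defensive.

Import GRing.Theory.
Local Open Scope ring_scope.

(** The half of Schur's lemma that holds over any field: the kernel and the
image of an intertwiner are submodules, hence trivial or everything. *)
Lemma schur_zero_or_iso (R : realType) (X : affine_type) (V V' : wmodule R X)
    (f : {linear V -> V'}) :
  irreducible_wmodule V -> irreducible_wmodule V' ->
  (forall w v, weyl w -> f (wmod_act V w v) = wmod_act V' w (f v)) ->
  (forall v, f v = 0) \/ iso_wmodule V V'.
Proof.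
move=> [_ irrV] [_ irrV'] f_eqv.
have [|||f_inj|?] := irrV (fun v => f v = 0); last by left.
- exact: linear0.
- by move=> c u v fu0 fv0; rewrite linearP fu0 fv0 scaler0 addr0.
- by move=> w u weyl_w fu0; rewrite f_eqv // fu0 linear0.
have [|||im0|f_surj] := irrV' (fun y => exists v, f v = y).
- by exists 0; apply: linear0.
- by move=> c _ _ [u <-] [v <-]; exists (c *: u + v); apply: linearP.
- by move=> w _ weyl_w [v <-]; exists (wmod_act V w v); apply: f_eqv.
- by left=> v; apply: im0; exists v.
right; exists f => //.
have [g gK] := choice f_surj.
exists g => // v; apply/eqP; rewrite -subr_eq0; apply/eqP/f_inj.
by rewrite linearB /= gK subrr.
Qed.

Lemma weyl_op_is_additive (R : realType) (X : affine_type) (l : nat)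
    (w : 'M[int]_(rank X)) : zmod_morphism (@weyl_op R X l w).
Proof. exact: lift_is_additive. Qed.

HB.instance Definition _ (R : realType) (X : affine_type) (l : nat)
    (w : 'M[int]_(rank X)) :=
  GRing.isZmodMorphism.Build _ _ (@weyl_op R X l w)
    (@weyl_op_is_additive R X l w).

(** The coordinates of a direct sum decomposition are unique, so they depend
linearly and equivariantly on the vector: these are the projections onto the
copies of the irreducible modules. *)
Lemma decomposition_coord (R : realType) (X : affine_type) (l : nat)
    (I : finType) (V : I -> wmodule R X) (n : I -> nat)
    (phi : forall i, 'I_(n i) -> {linear V i -> trunc_poly R X l}) :
  decomposition phi ->
  exists p : forall i, 'I_(n i) -> {linear trunc_poly R X l -> V i},
    (forall f, f = \sum_i \sum_j phi i j (p i j f)) /\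
    (forall i j w f, weyl w -> p i j (weyl_op w f) = wmod_act (V i) w (p i j f)).
Proof.
move=> [phi_eqv phi_span phi_free].
have [c cE] := choice phi_span.
have c_uniq f v : f = \sum_i \sum_j phi i j (v i j) ->
    forall i j, c f i j = v i j.
  move=> fE i j; apply/eqP; rewrite -subr_eq0; apply/eqP.
  apply: (phi_free (fun i j => c f i j - v i j)).
  under eq_bigr => k _ do
    (under eq_bigr => h _ do rewrite linearB; rewrite sumrB).
  by rewrite sumrB -cE -fE subrr.
have c_lin i j : linear (fun f => c f i j).
  move=> a f g.
  apply: (c_uniq _ (fun i j => a *: c f i j + c g i j)).
  under eq_bigr => k _ do
    (under eq_bigr => h _ do rewrite linearP; rewrite big_split -scaler_sumr).
  by rewrite big_split -scaler_sumr -!cE.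
exists (fun i j => HB.pack_for {linear trunc_poly R X l -> V i}
  (fun f => c f i j) (GRing.isLinear.Build _ _ _ _ _ (c_lin i j))).
split=> [f|i j w f weyl_w] /=; first exact: cE.
apply: (c_uniq _ (fun i j => wmod_act (V i) w (c f i j))).
rewrite {1}[f]cE raddf_sum; apply: eq_bigr => k _.
by rewrite raddf_sum; apply: eq_bigr => h _; rewrite phi_eqv.
Qed.

Lemma summand_sum (R : realType) (X : affine_type) (l : nat)
    (I : finType) (V : I -> wmodule R X) (n : I -> nat)
    (phi : forall i, 'I_(n i) -> {linear V i -> trunc_poly R X l}) (i : I)
    (J : finType) (f : J -> trunc_poly R X l) :
  (forall j, summand phi i (f j)) -> summand phi i (\sum_j f j).
Proof.
move=> /choice[v fE]; exists (fun h => \sum_j v j h).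
under eq_bigr => j _ do rewrite fE.
by rewrite exchange_big; apply: eq_bigr => h _; rewrite linear_sum.
Qed.

(** Schur's lemma kills every component of [F (phi i j v)] outside the i-th
isotypic summand. *)
Lemma commuting_op_summand (R : realType) (X : affine_type) (l : nat)
    (I : finType) (V : I -> wmodule R X) (n : I -> nat)
    (phi : forall i, 'I_(n i) -> {linear V i -> trunc_poly R X l})
    (F : {linear trunc_poly R X l -> trunc_poly R X l}) :
  irreducibles V -> decomposition phi ->
  (forall w f, weyl w -> F (weyl_op w f) = weyl_op w (F f)) ->
  forall i f, summand phi i f -> summand phi i (F f).
Proof.
move=> [V_irr V_iso _] phi_dec F_eqv i _ [v ->].
have [phi_eqv _ _] := phi_dec; have [p [pE p_eqv]] := decomposition_coord phi_dec.
rewrite linear_sum; apply: summand_sum => j.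
exists (fun h => p i h (F (phi i j (v j)))).
rewrite {1}[F _]pE (bigD1 i) //= [X in _ + X]big1 ?addr0 // => k k_neq_i.
rewrite big1 // => h _.
suff -> : p k h (F (phi i j (v j))) = 0 by rewrite linear0.
have pF_eqv w u : weyl w -> (p k h \o (F \o phi i j)) (wmod_act (V i) w u) =
    wmod_act (V k) w ((p k h \o (F \o phi i j)) u).
  by move=> weyl_w /=; rewrite phi_eqv // F_eqv // p_eqv.
have [pF0|iso_ik] := schur_zero_or_iso (V_irr i) (V_irr k) pF_eqv; first exact: pF0.
by rewrite (V_iso _ _ iso_ik) eqxx in k_neq_i.
Qed.

Theorem corollary4p7 (R : realType) (X : affine_type) (l : nat)
    (X_ok : affine_type_ok X) (l_gt0 : (0 < l)%N)
    (rho : 'M[int]_2 -> {linear trunc_poly R X l -> trunc_poly R X l})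
    (rho_action : projective_action rho)
    (I : finType) (V : I -> wmodule R X) (n : I -> nat)
    (phi : forall i, 'I_(n i) -> {linear V i -> trunc_poly R X l})
    (V_irr : irreducibles V) (phi_dec : decomposition phi) :
  (forall i, Gamma1_stable rho (summand phi i)) /\
  Gamma1_stable rho (@alternating R X l) /\
  Gamma1_stable rho (@invariants R X l).
Proof.
have [_ _ _ rho_eqv] := rho_action.
split=> [i g Gg f|]; last split=> g Gg f Uf w weyl_w.
- by apply: commuting_op_summand => // w f' weyl_w; apply: rho_eqv.
- by rewrite -rho_eqv // Uf // linearZ.
- by rewrite -rho_eqv // Uf.
Qed.
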